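(* Let $\Lambda$ be an artin algebra which is not a Nakayama algebra. Then $\Lambda$ is right $2$-Nakayama if and only if every indecomposable non-projective right $\Lambda$-module is uniserial.
   Context: An artin algebra is an algebra $\Lambda$ over a commutative artinian ring $R$ that is finitely generated as an $R$-module. All modules are finitely generated right $\Lambda$-modules. A module is uniserial if it has a unique composition series (the zero module counts as uniserial). $\Lambda$ is a Nakayama algebra if all indecomposable projective and all indecomposable injective right $\Lambda$-modules are uniserial. For a module $M$ put $\mathrm{rad}^0(M)=M$, $\mathrm{rad}^{i+1}(M)=\mathrm{rad}(\mathrm{rad}^i(M))$. Let $M$ be a nonzero module of length $l$. $M$ is $1$-factor serial if it is uniserial; for $l\ge 2$, $M$ is $2$-factor serial if $M/\mathrm{rad}^{l-2}(M)$ is uniserial and $M/\mathrm{rad}^{l-1}(M)$ is not uniserial. $\Lambda$ is right $2$-Nakayama if every indecomposable right $\Lambda$-module is $1$-factor serial or $2$-factor serial and there exists at least one indecomposable $2$-factor serial right $\Lambda$-module. *)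

(* Defs.v *)
From HB Require Import structures.
From mathcomp Require Import all_boot all_algebra.
From mathcomp Require Import boolp.

Set Implicit Arguments.
Unset Strict Implicit.
Unset Printing Implicit Defensive.

Import GRing.Theory.
Local Open Scope ring_scope.
Local Open Scope quotient_scope.

Section Quotient.
Variables (A : pzRingType) (M : lmodType A).
Variables (N : {pred M}) (subN : submod_closed N).

Definition quotmod_kernel : zmodClosed M :=
  HB.pack (N : M -> bool)
    (GRing.isZmodClosed.Build M (N : M -> bool) (GRing.submod_closedB subN)).

Definition quotmod : Type := Quotient.quot quotmod_kernel.
HB.instance Definition _ := GRing.Zmodule.on quotmod.

Definition quotmod_pi (x : M) : quotmod :=
  \pi_(Quotient.quot quotmod_kernel) x.

Lemma quotmod_piB x y : quotmod_pi (x - y) = quotmod_pi x - quotmod_pi y.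
Proof. exact: raddfB. Qed.

Lemma quotmod_piD x y : quotmod_pi (x + y) = quotmod_pi x + quotmod_pi y.
Proof. exact: raddfD. Qed.

Lemma quotmod_pi_eq x y : (quotmod_pi x == quotmod_pi y) = (x - y \in N).
Proof. by rewrite -[x - y \in N]/(x - y \in quotmod_kernel) Quotient.idealrBE. Qed.

Definition quotmod_repr (u : quotmod) : M := repr (u : Quotient.quot quotmod_kernel).

Lemma quotmod_reprK u : quotmod_pi (quotmod_repr u) = u.
Proof. exact: reprK. Qed.

Definition quotmod_scale (a : A) (u : quotmod) : quotmod :=
  quotmod_pi (a *: quotmod_repr u).

Lemma quotmod_piZ a x : quotmod_pi (a *: x) = quotmod_scale a (quotmod_pi x).
Proof.
have subZ x' : x' \in N -> a *: x' \in N.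
  by case: subN => N0 Nlin Nx'; rewrite -[a *: x']addr0; apply: Nlin.
apply/eqP; rewrite quotmod_pi_eq -scalerBr; apply: subZ.
by rewrite -quotmod_pi_eq quotmod_reprK.
Qed.

Lemma quotmod_scalerA a b u :
  quotmod_scale a (quotmod_scale b u) = quotmod_scale (a * b) u.
Proof. by rewrite -(quotmod_reprK u) -!quotmod_piZ scalerA. Qed.

Lemma quotmod_scale1r : left_id 1 quotmod_scale.
Proof. by move=> u; rewrite -(quotmod_reprK u) -quotmod_piZ scale1r. Qed.

Lemma quotmod_scalerDr : right_distributive quotmod_scale +%R.
Proof.
move=> a u v; rewrite -(quotmod_reprK u) -(quotmod_reprK v).
by rewrite -quotmod_piD -!quotmod_piZ scalerDr quotmod_piD.
Qed.

Lemma quotmod_scalerDl u : {morph quotmod_scale^~ u : a b / a + b}.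
Proof.
move=> a b; rewrite -(quotmod_reprK u).
by rewrite -!quotmod_piZ scalerDl quotmod_piD.
Qed.

HB.instance Definition _ := GRing.Zmodule_isLmodule.Build A quotmod
  quotmod_scalerA quotmod_scale1r quotmod_scalerDr quotmod_scalerDl.

End Quotient.

Section Modules.
Variable A : pzRingType.

Definition fin_gen (M : lmodType A) : Prop :=
  exists s : seq M, forall x : M,
    exists c : 'I_(size s) -> A, x = \sum_(i < size s) c i *: s`_i.

Definition zero_submod (M : lmodType A) : {pred M} := pred1 0.
Arguments zero_submod M : clear implicits.

Definition maximal_submod (M : lmodType A) (K N : {pred M}) : Prop :=
  [/\ submod_closed K, submod_closed N, {subset K <= N}, ~ {subset N <= K}
    & forall L : {pred M}, submod_closed L ->
        {subset K <= L} -> {subset L <= N} -> L =i K \/ L =i N].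

(* [s] lists the nonzero terms of a series [0 = M_0 < M_1 < ... < M_n = M], so
   that [size s] is its length. *)
Definition composition_series (M : lmodType A) (s : seq {pred M}) : Prop :=
  path (fun K N => `[< maximal_submod K N >]) (zero_submod M) s /\
  last (zero_submod M) s =i predT.

Definition has_length (M : lmodType A) (l : nat) : Prop :=
  exists2 s : seq {pred M}, composition_series s & size s = l.

Definition uniserial (M : lmodType A) : Prop :=
  exists! s : seq {pred M}, composition_series s.

(* The radical of the submodule [N], as a submodule of the ambient [M]. *)
Definition rad (M : lmodType A) (N : {pred M}) : {pred M} :=
  [pred x | (x \in N) &&
     `[< forall K : {pred M}, maximal_submod K N -> x \in K >]].

Definition radn (M : lmodType A) (i : nat) : {pred M} :=
  iter i (@rad M) predT.
Arguments radn M i : clear implicits.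

Lemma rad_submod_closed (M : lmodType A) (N : {pred M}) :
  submod_closed N -> submod_closed (rad N).
Proof.
move=> [N0 Nlin]; split=> [|a u v].
  by apply/andP; split=> //; apply/asboolP => K [] [].
move=> /andP[Nu /asboolP Ku] /andP[Nv /asboolP Kv].
apply/andP; split; first exact: Nlin.
apply/asboolP => K KN; case: (KN) => [[_ Klin] _ _ _ _].
by apply: Klin; [exact: Ku | exact: Kv].
Qed.

Lemma radn_submod_closed (M : lmodType A) i : submod_closed (radn M i).
Proof. by elim: i => [|i IHi] //=; exact: rad_submod_closed. Qed.

Definition nonzero (M : lmodType A) : Prop := exists x : M, x != 0.

Definition indecomposable (M : lmodType A) : Prop :=
  nonzero M /\
  forall U V : {pred M}, submod_closed U -> submod_closed V ->
    (forall x, exists u v, [/\ u \in U, v \in V & x = u + v]) ->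
    (forall x, x \in U -> x \in V -> x = 0) ->
    U =i zero_submod M \/ V =i zero_submod M.

(* Projectivity and injectivity are taken in the category of finitely
   generated modules. *)
Definition projective (P : lmodType A) : Prop :=
  forall X Y : lmodType A, fin_gen X -> fin_gen Y ->
  forall (g : {linear X -> Y}) (f : {linear P -> Y}),
    (forall y, exists x, g x = y) ->
    exists h : {linear P -> X}, forall p, g (h p) = f p.

Definition injective_module (I : lmodType A) : Prop :=
  forall X Y : lmodType A, fin_gen X -> fin_gen Y ->
  forall (g : {linear X -> Y}) (f : {linear X -> I}),
    injective g ->
    exists h : {linear Y -> I}, forall x, h (g x) = f x.

Definition one_factor_serial (M : lmodType A) : Prop :=
  nonzero M /\ uniserial M.

Definition two_factor_serial (M : lmodType A) : Prop :=
  exists l : nat, [/\ (2 <= l)%N, has_length M l,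
    uniserial (quotmod (radn_submod_closed M (l - 2)))
    & ~ uniserial (quotmod (radn_submod_closed M (l - 1)))].

End Modules.

Arguments zero_submod {A} M.
Arguments radn {A} M i.

Definition artinian_ring (R : comPzRingType) : Prop :=
  forall I : nat -> {pred R^o},
    (forall n, submod_closed (I n)) ->
    (forall n, {subset I n.+1 <= I n}) ->
    exists n, forall m, (n <= m)%N -> I m =i I n.

Definition artin_algebra (R : comPzRingType) (L : algType R) : Prop :=
  artinian_ring R /\ fin_gen L.

(* Right modules over [L] are left modules over the converse ring [L^c]. *)
Notation rmodType L := (lmodType (GRing.converse L)).

Definition nakayama (L : pzRingType) : Prop :=
  (forall M : rmodType L,
     fin_gen M -> indecomposable M -> projective M -> uniserial M) /\
  (forall M : rmodType L,
     fin_gen M -> indecomposable M -> injective_module M -> uniserial M).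

Definition right_two_nakayama (L : pzRingType) : Prop :=
  (forall M : rmodType L, fin_gen M -> indecomposable M ->
     one_factor_serial M \/ two_factor_serial M) /\
  (exists M : rmodType L,
     [/\ fin_gen M, indecomposable M & two_factor_serial M]).

(* Main.v *)
(* A non-uniserial module [M] of finite length is 2-factor serial if and only if
   all its quotients by nonzero submodules are uniserial. If [M] has length [l]
   and [M / rad^(l-2) M] is uniserial, every submodule either lies in
   [rad^(l-2) M], whose length is at most 2, or is one of the [rad^j M];
   conversely, the last nonzero term of the radical series has length 2.
   If every indecomposable is 1- or 2-factor serial and [M] is indecomposable and
   2-factor serial, then [M] is local, hence an image of an indecomposable
   projective [P]; as [M] is not uniserial it is not a proper quotient of [P], so
   [M] is projective. In the other direction, an indecomposable non-uniserial
   module is projective, hence local by Fitting's lemma, so that its proper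
   quotients are indecomposable and not projective, hence uniserial. *)

From HB Require Import structures.
From mathcomp Require Import all_boot all_algebra.
From mathcomp Require Import boolp.
Require Import Defs.

Set Implicit Arguments.
Unset Strict Implicit.
Unset Printing Implicit Defensive.

Import GRing.Theory.
Local Open Scope ring_scope.

(** * The lattice of submodules, and linear maps *)

Section Submodules.
Variables (A : pzRingType) (M : lmodType A).
Implicit Types (U V W K N : {pred M}).

Lemma submod0 U : submod_closed U -> 0 \in U.
Proof. by case. Qed.

Lemma submodD U : submod_closed U -> {in U &, forall x y, x + y \in U}.
Proof. by case=> _ h x y Ux Uy; rewrite -[x]scale1r h. Qed.

Lemma submodZ U a : submod_closed U -> {in U, forall x, a *: x \in U}.
Proof. by case=> h0 h x Ux; rewrite -[_ *: _]addr0 h. Qed.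

Lemma submodN U : submod_closed U -> {in U, forall x, - x \in U}.
Proof. by move=> h x Ux; rewrite -scaleN1r submodZ. Qed.

Lemma submodB U : submod_closed U -> {in U &, forall x y, x - y \in U}.
Proof. by move=> h x y Ux Uy; rewrite submodD // submodN. Qed.

Lemma eq_submod U V : {subset U <= V} -> {subset V <= U} -> U = V.
Proof. by move=> UV VU; apply: funext => x; apply/idP/idP => [/UV|/VU]. Qed.

Lemma eqi_submod U V : U =i V -> U = V.
Proof. by move=> eUV; apply: eq_submod => x; rewrite eUV. Qed.

Definition addsm U V : {pred M} :=
  [pred x | `[< exists u v, [/\ u \in U, v \in V & x = u + v] >]].

Definition capsm U V : {pred M} := [pred x | (x \in U) && (x \in V)].

Lemma addsmP U V x :
  reflect (exists u v, [/\ u \in U, v \in V & x = u + v]) (x \in addsm U V).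
Proof. exact: asboolP. Qed.

Lemma addsm_closed U V :
  submod_closed U -> submod_closed V -> submod_closed (addsm U V).
Proof.
move=> hU hV; split=> [|a x y].
  by apply/addsmP; exists 0, 0; rewrite addr0 !submod0.
case/addsmP=> u [v [Uu Vv ->]] /addsmP[u' [v' [Uu' Vv' ->]]].
apply/addsmP; exists (a *: u + u'), (a *: v + v').
by split; rewrite ?submodD ?submodZ // scalerDr addrACA.
Qed.

Lemma sub_addsml U V : submod_closed V -> {subset U <= addsm U V}.
Proof. by move=> hV x Ux; apply/addsmP; exists x, 0; rewrite addr0 submod0. Qed.

Lemma sub_addsmr U V : submod_closed U -> {subset V <= addsm U V}.
Proof. by move=> hU x Vx; apply/addsmP; exists 0, x; rewrite add0r submod0. Qed.

Lemma addsm_sub U V W : submod_closed W ->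
  {subset U <= W} -> {subset V <= W} -> {subset addsm U V <= W}.
Proof.
by move=> hW UW VW x /addsmP[u [v [/UW Wu /VW Wv ->]]]; rewrite submodD.
Qed.

Lemma capsm_closed U V :
  submod_closed U -> submod_closed V -> submod_closed (capsm U V).
Proof.
move=> hU hV; split=> [|a x y]; first by rewrite inE !submod0.
by rewrite !inE => /andP[Ux Vx] /andP[Uy Vy]; rewrite !submodD ?submodZ.
Qed.

Lemma predT_closed : submod_closed (predT : {pred M}).
Proof. by []. Qed.

Lemma zero_submod_closed : submod_closed (zero_submod M).
Proof.
split=> [|a x y]; first by rewrite inE.
by rewrite !inE => /eqP-> /eqP->; rewrite scaler0 addr0.
Qed.

Lemma sub_zero U : submod_closed U -> {subset zero_submod M <= U}.
Proof. by move=> hU x; rewrite inE => /eqP->; apply: submod0. Qed.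

Lemma submod_neq0 U : submod_closed U -> U <> zero_submod M ->
  exists2 x, x \in U & x <> 0.
Proof.
move=> hU U0; apply: contrapT => h; apply: U0; apply: eq_submod.
  by move=> x Ux; rewrite inE; apply/eqP; apply: contrapT => x0; apply: h; exists x.
exact: sub_zero.
Qed.

Lemma nsubset U V : ~ {subset U <= V} -> exists2 x, x \in U & x \notin V.
Proof.
move=> h; apply: contrapT => h'; apply: h => x Ux.
by apply: contrapT => /negP Vx; apply: h'; exists x.
Qed.

Definition cyclicsm (x : M) : {pred M} := [pred y | `[< exists a, y = a *: x >]].

Lemma cyclicsmP x y : reflect (exists a, y = a *: x) (y \in cyclicsm x).
Proof. exact: asboolP. Qed.

Lemma cyclicsm_closed x : submod_closed (cyclicsm x).
Proof.
split=> [|a u v]; first by apply/cyclicsmP; exists 0; rewrite scale0r.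
case/cyclicsmP=> b -> /cyclicsmP[c ->].
by apply/cyclicsmP; exists (a * b + c); rewrite scalerDl scalerA.
Qed.

Lemma cyclicsm_sub x U : submod_closed U -> x \in U -> {subset cyclicsm x <= U}.
Proof. by move=> hU Ux y /cyclicsmP[a ->]; apply: submodZ. Qed.

Lemma mem_cyclicsm x : x \in cyclicsm x.
Proof. by apply/cyclicsmP; exists 1; rewrite scale1r. Qed.

End Submodules.

Section LinearMaps.
Variables (A : pzRingType) (P Q : lmodType A) (f : {linear P -> Q}).

Definition preimsm (U : {pred Q}) : {pred P} := [pred x | f x \in U].

Definition imsm (U : {pred P}) : {pred Q} :=
  [pred y | `[< exists2 x, x \in U & y = f x >]].

Lemma imsmP U y : reflect (exists2 x, x \in U & y = f x) (y \in imsm U).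
Proof. exact: asboolP. Qed.

Lemma preimsm_closed U : submod_closed U -> submod_closed (preimsm U).
Proof.
move=> hU; split=> [|a x y]; first by rewrite inE linear0 submod0.
by rewrite !inE linearP => Ux Uy; rewrite submodD ?submodZ.
Qed.

Lemma imsm_closed U : submod_closed U -> submod_closed (imsm U).
Proof.
move=> hU; split=> [|a x y].
  by apply/imsmP; exists 0; rewrite ?linear0 ?submod0.
case/imsmP=> x' Ux -> /imsmP[y' Uy ->]; apply/imsmP.
by exists (a *: x' + y'); rewrite ?linearP ?submodD ?submodZ.
Qed.

Lemma mem_imsm U x : x \in U -> f x \in imsm U.
Proof. by move=> Ux; apply/imsmP; exists x. Qed.

End LinearMaps.

Lemma exists_linear (A : pzRingType) (P Q : lmodType A) (f : P -> Q) :
  linear f -> exists g : {linear P -> Q}, g =1 f.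
Proof.
move=> lf; pose fl : {linear P -> Q} :=
  HB.pack f (GRing.isLinear.Build A P Q *:%R f lf).
by exists fl.
Qed.

(** * Chain conditions *)

Section ChainConditions.
Variables (A : pzRingType) (M : lmodType A).
Implicit Types (U V K N : {pred M}) (d : bool).

(** The boolean lets the ascending ([true]) and the descending ([false]) chain condition share their
    proofs. *)
Definition directed_sub d U V : Prop :=
  if d then {subset U <= V} else {subset V <= U}.

(** The chain condition on [N] is stated inside the ambient [M], so that [N] need not be turned into
    a module type. *)
Definition stable_in d N : Prop :=
  forall I : nat -> {pred M}, (forall n, submod_closed (I n)) ->
    (forall n, {subset I n <= N}) ->
    (forall n, directed_sub d (I n) (I n.+1)) ->
    exists n, forall m, (n <= m)%N -> I m = I n.

Lemma directed_sub_refl d U : directed_sub d U U.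
Proof. by case: d => x. Qed.

Lemma directed_sub_trans d V U K :
  directed_sub d U V -> directed_sub d V K -> directed_sub d U K.
Proof. by case: d => UV VK x; [move/UV/VK|move/VK/UV]. Qed.

Lemma directed_sub_le d (I : nat -> {pred M}) n m :
  (forall n, directed_sub d (I n) (I n.+1)) -> (n <= m)%N ->
  directed_sub d (I n) (I m).
Proof.
move=> hI /subnK <-; elim: (m - n)%N => [|k IH]; first exact: directed_sub_refl.
exact: directed_sub_trans IH (hI _).
Qed.

(** An instance of the modular law: if x = u + k, then k = x - u lies in V ∩ K, hence in [U]. *)
Lemma sub_of_cap_add K U V : submod_closed V -> {subset U <= V} ->
  {subset capsm V K <= U} -> {subset V <= addsm U K} -> submod_closed U ->
  {subset V <= U}.
Proof.
move=> hV UV VKU VUK hU x Vx; have /addsmP[u [k [Uu Kk def_x]]] := VUK x Vx.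
rewrite def_x; apply: submodD => //; apply: VKU; rewrite inE Kk andbT.
have -> : k = x - u by rewrite def_x addrAC subrr add0r.
by apply: submodB => //; apply: UV.
Qed.

(** The last hypothesis stands for the chain condition on N / K. A chain in [N] is cut with [K] and
    enlarged by [K]; once both derived chains are constant, the modular law makes the chain itself
    constant. *)
Lemma stable_in_ext d K N : submod_closed K -> submod_closed N ->
  {subset K <= N} -> stable_in d K ->
  (forall J : nat -> {pred M}, (forall n, submod_closed (J n)) ->
     (forall n, {subset K <= J n}) -> (forall n, {subset J n <= N}) ->
     (forall n, directed_sub d (J n) (J n.+1)) ->
     exists n, forall m, (n <= m)%N -> J m = J n) ->
  stable_in d N.
Proof.
move=> hK hN KN stK stKN I hI IN monoI.
have [||| n1 st1] := stK (fun n => capsm (I n) K).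
- by move=> n; apply: capsm_closed.
- by move=> n x; rewrite inE => /andP[].
- move=> n; move: (monoI n); case: (d) => h x; rewrite !inE => /andP[/h Ix Kx];
    exact/andP.
have [|||| n2 st2] := stKN (fun n => addsm (I n) K).
- by move=> n; apply: addsm_closed.
- by move=> n; apply: sub_addsmr.
- by move=> n; apply: addsm_sub.
- move=> n; move: (monoI n); case: (d) => h;
  by apply: addsm_sub; [apply: addsm_closed | move=> x /h; apply: sub_addsml
    | apply: sub_addsmr].
pose n := maxn n1 n2; exists n => m le_nm.
have le_n1 : (n1 <= n)%N by apply: leq_maxl.
have le_n2 : (n2 <= n)%N by apply: leq_maxr.
have e1 : capsm (I m) K = capsm (I n) K.
  by rewrite (st1 m) ?(st1 n) // (leq_trans le_n1).
have e2 : addsm (I m) K = addsm (I n) K.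
  by rewrite (st2 m) ?(st2 n) // (leq_trans le_n2).
have eqI U V : submod_closed U -> submod_closed V -> {subset U <= V} ->
    capsm U K = capsm V K -> addsm U K = addsm V K -> U = V.
  move=> hU hV UV ec ea; apply: eq_submod => //.
  apply: (@sub_of_cap_add K) => //; last by rewrite ea; apply: sub_addsml.
  by rewrite -ec => x; rewrite inE => /andP[].
have := directed_sub_le monoI le_nm.
by case: (d) => /eqI h; [apply/esym|]; apply: h.
Qed.

Lemma stable_in_zero d : stable_in d (zero_submod M).
Proof.
move=> I hI I0 _; exists 0%N => m _; apply: eq_submod => x /I0;
  by rewrite inE => /eqP->; apply: submod0.
Qed.

Lemma stable_in_sub d N N' : {subset N' <= N} -> stable_in d N -> stable_in d N'.
Proof. by move=> sN h I hI IN; apply: h => // n x /IN/sN. Qed.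

Definition chain_cond d := stable_in d predT.

(** If no member were extremal, choosing a strictly larger (or smaller) member again and again would
    give a chain that never stabilises. *)
Lemma chain_cond_extremum d (Pr : {pred M} -> Prop) : chain_cond d ->
  (forall U, Pr U -> submod_closed U) -> (exists U, Pr U) ->
  exists2 U, Pr U & forall V, Pr V -> directed_sub d U V -> V = U.
Proof.
move=> cc hPr [U0 PU0]; apply: contrapT => nex.
have step (s : {U | Pr U}) :
    exists t : {U | Pr U}, directed_sub d (sval s) (sval t) /\ sval t <> sval s.
  case: s => U PU /=; apply: contrapT => h; apply: nex; exists U => // V PV UV.
  by apply: contrapT => VU; apply: h; exists (exist _ V PV).
have [f hf] := choice step.
pose I n := sval (iter n f (exist _ U0 PU0)).
have [|||n st] := cc I.
- by move=> n; apply: hPr; apply: proj2_sig.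
- by [].
- by move=> n; case: (hf (iter n f (exist _ U0 PU0))).
by case: (hf (iter n f (exist _ U0 PU0))) => _; apply; apply: (st n.+1).
Qed.

End ChainConditions.

(** * Finitely generated modules *)

Section FinitelyGenerated.
Variables (A : pzRingType).

Fixpoint spansm (M : lmodType A) (s : seq M) : {pred M} :=
  if s is x :: s' then addsm (cyclicsm x) (spansm s') else zero_submod M.

Lemma spansm_closed (M : lmodType A) (s : seq M) : submod_closed (spansm s).
Proof.
elim: s => [|x s IH] /=; first exact: zero_submod_closed.
by apply: addsm_closed => //; apply: cyclicsm_closed.
Qed.

Lemma mem_spansm (M : lmodType A) (s : seq M) (c : 'I_(size s) -> A) :
  \sum_(i < size s) c i *: s`_i \in spansm s.
Proof.
elim: s c => [|x s IH] c /=; first by rewrite big_ord0 inE.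
rewrite big_ord_recl /=; apply/addsmP.
exists (c ord0 *: x), (\sum_(i < size s) c (lift ord0 i) *: s`_i).
by split=> //; apply/cyclicsmP; exists (c ord0).
Qed.

Lemma fin_genP (M : lmodType A) :
  fin_gen M <-> exists s : seq M, forall x, x \in spansm s.
Proof.
split=> [] [s hs]; exists s => x.
  by have [c ->] := hs x; apply: mem_spansm.
move: {hs} (hs x); elim: s x => [|y s IH] x /=.
  by rewrite inE => /eqP->; exists (fun=> 0); rewrite big_ord0.
case/addsmP=> _ [v [/cyclicsmP[a ->] /IH[c ->] ->]].
exists (fun i => if unlift ord0 i is Some j then c j else a).
rewrite big_ord_recl unlift_none /=; congr (_ + _); apply: eq_bigr => i _.
by rewrite liftK.
Qed.

Lemma fin_gen_chain_cond d (M : lmodType A) :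
  chain_cond A^o d -> fin_gen M -> chain_cond M d.
Proof.
move=> ccA [s hs].
have st : stable_in d (spansm s).
  elim: {hs} s => [|x s IH] /=; first exact: stable_in_zero.
  have hs := spansm_closed s; have hx := cyclicsm_closed x.
  apply: (stable_in_ext hs) => //; first exact: addsm_closed.
    exact: sub_addsmr.
  move=> J hJ sJ Jxs monoJ.
  (* A chain between the span of [s] and that of [x :: s] is determined by the left ideals of the
     possible coefficients of [x]. *)
  pose I n : {pred A^o} := [pred a | a *: x \in J n].
  have [|||n stn] := ccA I.
  - move=> n; split=> [|a b c]; first by rewrite inE scale0r submod0.
    rewrite !inE => Jb Jc.
    rewrite scalerDl -[a *: b]/(a * b) -scalerA.
    by apply: submodD => //; apply: submodZ.
  - by [].
  - by move=> n; move: (monoJ n); case: (d) => h a; rewrite !inE; apply: h.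
  have sub m m' : (n <= m)%N -> (n <= m')%N -> {subset J m <= J m'}.
    move=> le_nm le_nm' v Jv.
    have /addsmP[_ [w [/cyclicsmP[a ->] sw def_v]]] := Jxs _ _ Jv.
    have: a \in I m.
      rewrite inE (_ : a *: x = v - w); first by rewrite submodB // sJ.
      by rewrite def_v addrK.
    rewrite (stn m) // -(stn m') // inE => Ja.
    by rewrite def_v submodD // sJ.
  by exists n => m le_nm; apply: eq_submod; apply: sub.
apply: stable_in_sub st => x _.
by have [c ->] := hs x; apply: mem_spansm.
Qed.

End FinitelyGenerated.

(* Akizuki: an ideal [I] minimal among those violating the ascending chain
   condition satisfies [x I = I] or [x I = 0] for every [x], so that the ring
   acts on [I] through a field; an infinite independent family in [I] then
   yields an infinite descending chain. *)
Section Akizuki.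
Variable R : comPzRingType.
Hypothesis dccR : chain_cond R^o false.

Variable I : {pred R^o}.
Hypothesis hI : submod_closed I.
Hypothesis naccI : ~ stable_in true I.
Hypothesis minI : forall V : {pred R^o}, submod_closed V ->
  {subset V <= I} -> V <> I -> stable_in true V.

(** Multiplication by [x] presents [I] as an extension of x I by its kernel in [I]. If both were
    proper in [I], minimality would give them the ascending chain condition, and [I] would inherit
    it. *)
Lemma min_bad_ideal_dichotomy (x : R) :
  (forall i : R^o, i \in I -> x *: i = 0) \/
  (forall i : R^o, i \in I -> exists2 j, j \in I & i = x *: j).
Proof.
have [f fE] : exists f : {linear R^o -> R^o}, f =1 (fun v => x *: v).
  apply: exists_linear => a u v.
  by rewrite scalerDr !scalerA mulrC.
pose K := capsm I (preimsm f (zero_submod _)).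
have hK : submod_closed K.
  by apply: capsm_closed => //; apply/preimsm_closed/zero_submod_closed.
have sKI : {subset K <= I} by move=> i; rewrite inE => /andP[].
have inK i : (i \in K) = (i \in I) && (x *: i == 0).
  by rewrite inE; congr (_ && _); rewrite inE fE inE.
have sxI : {subset imsm f I <= I}.
  by move=> _ /imsmP[i Ii ->]; rewrite fE; apply: submodZ.
have hxI := imsm_closed f hI.
have [eK|/minI accK] := EM (K = I).
  by left=> i; rewrite -{1}eK inK => /andP[_ /eqP].
have [exI|/minI accxI] := EM (imsm f I = I).
  by right=> i; rewrite -{1}exI => /imsmP[j Ij ->]; exists j; rewrite ?fE.
case: naccI; apply: (stable_in_ext hK) => //; first exact: accK.
move=> J hJ sJ JI monoJ.
have [|||n stn] := accxI hxI sxI (fun n => imsm f (J n)).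
- by move=> n; apply: imsm_closed.
- by move=> n _ /imsmP[v /JI Iv ->]; apply: mem_imsm.
- by move=> n _ /imsmP[v /monoJ Jv ->]; apply: mem_imsm.
exists n => m le_nm; apply: eq_submod; last exact: (directed_sub_le monoJ).
move=> v Jv; have: f v \in imsm f (J m) by apply: mem_imsm.
rewrite stn // => /imsmP[w Jw]; rewrite !fE => xvw.
rewrite -(subrK w v); apply: submodD => //; apply: sJ.
by rewrite inK scalerBr xvw subrr eqxx (submodB hI (JI _ _ Jv) (JI _ _ Jw)).
Qed.

(** The ideals generated by the powers of [x] stabilise, so x^n = y x^(n+1) for some [n] and [y]. If
    x I = I, every element of [I] has the form x^n j, and there [y] undoes [x]. *)
Lemma min_bad_ideal_inverse (x : R) :
  (forall i : R^o, i \in I -> x *: i = 0) \/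
  exists y, forall i : R^o, i \in I -> y *: (x *: i) = i.
Proof.
have [|onto] := min_bad_ideal_dichotomy x; [by left | right].
have ontoX n i : i \in I -> exists2 j, j \in I & i = x ^+ n *: j.
  elim: n i => [|n IH] i Ii; first by exists i; rewrite ?expr0 ?scale1r.
  have [j /onto[k Ik ->] ->] := IH i Ii.
  by exists k; rewrite // scalerA exprSr.
have [|||n stn] := dccR (I := fun n => cyclicsm (x ^+ n : R^o)).
- by move=> n; apply: cyclicsm_closed.
- by [].
- move=> n; apply: cyclicsm_sub; first exact: cyclicsm_closed.
  by apply/cyclicsmP; exists x; rewrite exprS.
have: (x ^+ n : R^o) \in cyclicsm (x ^+ n.+1 : R^o).
  by rewrite stn //; apply: mem_cyclicsm.
case/cyclicsmP=> y def_xn; exists y => i /(ontoX n)[j Ij ->].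
rewrite !scalerA -mulrA -exprS; congr (_ *: j).
exact: esym def_xn.
Qed.

Lemma min_bad_ideal_absurd : False.
Proof.
apply: naccI => U hU UI monoU; apply: contrapT => nst.
have step n : exists p : nat * R^o,
    [/\ (n <= p.1)%N, p.2 \in U p.1 & p.2 \notin U n].
  apply: contrapT => h; apply: nst; exists n => m le_nm.
  apply: eq_submod; last exact: (directed_sub_le monoU).
  by move=> x Ux; apply: contrapT => /negP Un; apply: h; exists (m, x).
have [p hp] := choice step.
(* Thinning out the chain gives [W] with z_k in W (k+1) but not in W k; these [z] are the
   independent family. *)
pose t k := iter k (fun n => (p n).1) 0%N.
pose W k := U (t k); pose z k := (p (t k)).2.
have zW k : z k \in W k.+1 by case: (hp (t k)).
have zNW k : z k \notin W k by case: (hp (t k)).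
have monoW k : directed_sub true (W k) (W k.+1).
  by apply: (directed_sub_le monoU); case: (hp (t k)).
have leW k m : (k <= m)%N -> {subset W k <= W m}.
  exact: (directed_sub_le (d := true)).
have hW k : submod_closed (W k) by apply: hU.
have WI k : {subset W k <= I} by apply: UI.
(* [T n N] is the span of z_n, ..., z_(n+N-1). *)
pose fix T n N : {pred R^o} :=
  if N is N'.+1 then addsm (T n N') (cyclicsm (z (n + N')%N)) else zero_submod _.
have T_S n N : T n N.+1 = addsm (T n N) (cyclicsm (z (n + N)%N)) by [].
have hT n N : submod_closed (T n N).
  elim: N => [|N IH]; first exact: zero_submod_closed.
  by rewrite T_S; apply: addsm_closed => //; apply: cyclicsm_closed.
have leT n N N' : (N <= N')%N -> {subset T n N <= T n N'}.
  apply: (directed_sub_le (d := true)) => {N N'} N; rewrite T_S.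
  by apply: sub_addsml; apply: cyclicsm_closed.
have zT n : z n \in T n 1%N.
  rewrite T_S addn0; apply: sub_addsmr (mem_cyclicsm _).
  exact: zero_submod_closed.
have TW n N : {subset T n N <= W (n + N)%N}.
  elim: N => [|N IH]; first exact: sub_zero.
  rewrite T_S; apply: addsm_sub => // [x /IH|].
    by apply: leW; rewrite addnS.
  by apply: cyclicsm_sub => //; rewrite addnS.
have TS n N : {subset T n.+1 N <= T n N.+1}.
  elim: N => [|N IH]; first by apply: sub_zero.
  rewrite T_S; apply: addsm_sub => // [x /IH|]; first exact: leT.
  rewrite [X in {subset _ <= X}]T_S addSnnS; apply: sub_addsmr; exact: (hT n N.+1).
(* [V n] is the span of all z_m with m >= n; these spans decrease. *)
pose V n : {pred R^o} := [pred v | `[< exists N, v \in T n N >]].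
have VP n v : reflect (exists N, v \in T n N) (v \in V n) by apply: asboolP.
have [|||n stn] := dccR (I := V).
- move=> n; split; first by apply/VP; exists 0%N; apply: submod0.
  move=> a u v /VP[N1 Tu] /VP[N2 Tv]; apply/VP; exists (maxn N1 N2).
  apply: submodD => //; first apply: submodZ => //.
    by apply: leT Tu; apply: leq_maxl.
  by apply: leT Tv; apply: leq_maxr.
- by [].
- by move=> n v /VP[N /TS Tv]; apply/VP; exists N.+1.
have: z n \in V n.+1.
  by rewrite stn //; apply/VP; exists 1%N.
(* Consider the last term a z_(n+1+N) in an expression of z_n. Either [a] kills [I] and the term
   drops out, or [a] is invertible on [I] and z_(n+1+N) would lie in W (n+1+N). *)
case/VP; elim=> [|N IH].
  by rewrite inE => /eqP z0; move: (zNW n); rewrite z0 submod0.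
rewrite T_S => /addsmP[v [_ [Tv /cyclicsmP[a ->] def_z]]].
have [a0|[y ya1]] := min_bad_ideal_inverse a.
  by apply: IH; rewrite def_z a0 ?addr0 // (WI _ _ (zW _)).
have: a *: z (n.+1 + N)%N \in W (n.+1 + N)%N.
  rewrite -[_ *: _](addKr v) -def_z addrC; apply: submodB => //; last exact: TW.
  by apply: leW (zW n); rewrite leq_addr.
move/(submodZ y (hW _)); rewrite ya1; first by apply/negP.
exact: WI (zW _).
Qed.

End Akizuki.

Lemma artinian_noetherian (R : comPzRingType) :
  chain_cond R^o false -> chain_cond R^o true.
Proof.
move=> dcc; apply: contrapT => nacc.
have [|| I [hI nI] minI] := chain_cond_extremum
  (Pr := fun U => submod_closed U /\ ~ stable_in true U) dcc.
- by move=> U [].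
- by exists (fun=> true); split.
apply: (min_bad_ideal_absurd dcc hI nI) => V hV VI VnI.
by apply: contrapT => nV; apply: VnI; apply: minI.
Qed.

Lemma artin_algebra_chain_cond (R : comPzRingType) (L : algType R) d
    (M : rmodType L) :
  artin_algebra L -> fin_gen M -> chain_cond M d.
Proof.
case=> artR fgL; apply: fin_gen_chain_cond.
have dccR : chain_cond R^o false.
  move=> I hI _ monoI; have [n st] := artR I hI monoI.
  by exists n => m /st/eqi_submod.
have ccL : chain_cond L d.
  apply: fin_gen_chain_cond fgL; case: d => //; exact: artinian_noetherian.
(* Right ideals of [L] are [R]-submodules, because [a *: u] is the product of [u] with [a *: 1]. *)
move=> I hI _ monoI; apply: (ccL I) => // n.
split=> [|a u v Iu Iv]; first exact: submod0 (hI n).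
apply: (submodD (hI n)) => //.
rewrite (_ : a *: u = (u : L) * (a *: 1)); last by rewrite -scalerAr mulr1.
exact: (@submodZ _ _ _ (a *: (1 : L) : GRing.converse L) (hI n) u Iu).
Qed.

(** * Composition series, radicals and uniserial modules *)

Definition finite_length (A : pzRingType) (M : lmodType A) : Prop :=
  forall d, chain_cond M d.

Section Lattice.
Variables (A : pzRingType) (M : lmodType A).
Implicit Types (U V W K L N : {pred M}) (s : seq {pred M}).

(** For [M] of finite length this is the lattice form of M / N being uniserial, without passing to
    the quotient type. *)
Definition chain_above N : Prop := forall U V,
  submod_closed U -> submod_closed V -> {subset N <= U} -> {subset N <= V} ->
  {subset U <= V} \/ {subset V <= U}.

Lemma chain_above_sub N N' : {subset N <= N'} -> chain_above N -> chain_above N'.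
Proof.
by move=> NN' cN U V hU hV N'U N'V; apply: cN => // x /NN'; [apply: N'U|apply: N'V].
Qed.

Lemma maximal_submod_eq K K' N :
  maximal_submod K N -> maximal_submod K' N -> {subset K <= K'} -> K = K'.
Proof.
move=> [_ _ _ _ maxK] [hK' _ K'N nNK' _] KK'.
by case: (maxK K' hK' KK' K'N) => /eqi_submod // eK'; case: nNK'; rewrite -eK'.
Qed.

Lemma maximal_submod_add K N V : maximal_submod K N -> submod_closed V ->
  {subset V <= N} -> ~ {subset V <= K} -> addsm V K = N.
Proof.
move=> [hK hN KN nNK maxK] hV VN nVK.
have hVK := addsm_closed hV hK.
have [||||] := maxK (addsm V K) => //.
- exact: sub_addsmr.
- exact: addsm_sub.
- move=> eVK; case: nVK => x Vx; rewrite -eVK.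
  exact: sub_addsml.
- exact: eqi_submod.
Qed.

Definition step K N : bool := `[< maximal_submod K N >].

Lemma path_sub K s : path step K s -> {subset K <= last K s}.
Proof.
elim: s K => [|N s IH] K /=; first by move=> _ x.
by move=> /andP[/asboolP[_ _ KN _ _] /IH Ns] x /KN; apply: Ns.
Qed.

(** For submodules [U] and [K] with [K] maximal in [N], a jump means that U ∩ N covers the whole
    composition factor N / K. *)
Definition jump U K N : bool := ~~ `[< {subset capsm U N <= K} >].

Fixpoint jumps U K s : nat :=
  if s is N :: s' then (jump U K N + jumps U N s')%N else 0%N.

Lemma jumps_le_size U K s : (jumps U K s <= size s)%N.
Proof. by elim: s K => //= N s IH K; rewrite -add1n leq_add ?leq_b1. Qed.

Lemma jump_mono U V K N : {subset U <= V} -> (jump U K N <= jump V K N)%N.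
Proof.
move=> UV; rewrite /jump; case: asboolP; case: asboolP => // h h'.
by case: h' => x; rewrite inE => /andP[/UV Vx Nx]; apply: h; rewrite inE Vx.
Qed.

Lemma jumps_mono U V K s : {subset U <= V} -> (jumps U K s <= jumps V K s)%N.
Proof. by move=> UV; elim: s K => //= N s IH K; rewrite leq_add ?jump_mono. Qed.

(** Each step counts at most as much for [U] as for [V], so equal totals force equality at each
    step. Without a jump, V ∩ N lies in [K], where [U] and [V] agree; with one, N = (U ∩ N) + K, and
    an element of V ∩ N differs from one of [U] by an element of V ∩ K. *)
Lemma jumps_eq U V K s : submod_closed U -> submod_closed V -> {subset U <= V} ->
  path step K s -> capsm U K = capsm V K -> jumps U K s = jumps V K s ->
  capsm U (last K s) = capsm V (last K s).
Proof.
move=> hU hV UV; elim: s K => //= N s IH K /andP[/asboolP mKN Ns] eK ej.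
have lej := jump_mono K N UV; have lejs := jumps_mono N s UV.
have [ejN ejs] : jump U K N = jump V K N /\ jumps U N s = jumps V N s.
  have ejs : jumps U N s = jumps V N s.
    apply/eqP; rewrite eqn_leq lejs -(leq_add2l (jump V K N)) -ej.
    by rewrite leq_add2r.
  split=> //; move/eqP: ej; rewrite ejs eqn_add2r.
  by case: (jump U _ _); case: (jump V _ _).
apply: IH => //; case: (mKN) => hK hN KN _ _.
apply: eq_submod => x; rewrite !inE => /andP[Vx Nx]; first by rewrite UV.
rewrite Nx andbT; move: ejN; rewrite /jump.
have sub1 y : y \in V -> y \in K -> y \in U.
  move=> Vy Ky; have : y \in capsm V K by rewrite inE Vy.
  by rewrite -eK inE => /andP[].
case: asboolP => [_|nUN].
  case: asboolP => // VNK _; apply: sub1 => //; apply: VNK.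
  by rewrite inE Vx.
move=> _; have hUN := capsm_closed hU hN.
have := maximal_submod_add mKN hUN _ nUN.
move=> /(_ _)/wrap[y|eN]; first by rewrite inE => /andP[].
move: (Nx); rewrite -{1}eN => /addsmP[u [k [+ Kk def_x]]].
rewrite inE => /andP[Uu _]; rewrite def_x; apply: submodD => //; apply: sub1 => //.
have -> : k = x - u by rewrite def_x addrAC subrr add0r.
by apply: submodB => //; apply: UV.
Qed.

Lemma jumps_zero K s : submod_closed K -> path step K s ->
  jumps (zero_submod M) K s = 0%N.
Proof.
elim: s K => //= N s IH K hK /andP[/asboolP[_ hN _ _ _] ps].
rewrite IH // addn0 /jump; case: asboolP => //; case=> x.
by rewrite inE => /andP[+ _]; apply: sub_zero.
Qed.

(* Counting the jumps of [U] along a composition series replaces the length of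
   [U] and saves the Jordan-Hölder theorem. *)
Lemma composition_series_rank s : composition_series s ->
  exists rk : {pred M} -> nat, [/\ rk (zero_submod M) = 0%N,
    forall U, (rk U <= size s)%N &
    forall U V, submod_closed U -> submod_closed V -> {subset U <= V} ->
      U <> V -> (rk U < rk V)%N].
Proof.
case=> path_s /eqi_submod last_s.
exists (fun U => jumps U (zero_submod M) s); split=> [|U|U V hU hV UV nUV].
- by apply: jumps_zero path_s; apply: zero_submod_closed.
- exact: jumps_le_size.
rewrite ltn_neqAle jumps_mono // andbT; apply/negP => /eqP.
move/(jumps_eq hU hV UV path_s); rewrite last_s => h; apply: nUV.
apply: eq_submod => // x Vx.
have : x \in capsm V predT by rewrite inE Vx.
rewrite -h ?inE; first by case/andP.
by apply: eq_submod => y; rewrite !inE => /andP[_ /eqP->]; rewrite eqxx submod0.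
Qed.

Hypothesis flM : finite_length M.

Lemma exists_maximal K N : submod_closed K -> submod_closed N ->
  {subset K <= N} -> K <> N -> exists2 L, maximal_submod L N & {subset K <= L}.
Proof.
move=> hK hN KN nKN.
have [|| L [hL KL LN nLN] maxL] := chain_cond_extremum (Pr := fun L =>
  [/\ submod_closed L, {subset K <= L}, {subset L <= N} & L <> N]) (flM (d := true)).
- by move=> L [].
- by exists K; split.
exists L => //; split=> // [NL|L' hL' LL' L'N].
  by apply: nLN; apply: eq_submod.
have [->|nL'N] := EM (L' = N); first by right.
by left; rewrite (maxL L') //; split=> // x /KL/LL'.
Qed.

(** A minimal [L] not reachable from [K] differs from [K], so it has a maximal submodule above [K].
    That one is reachable by minimality, and one more step reaches [L]. *)
Lemma exists_path K N : submod_closed K -> submod_closed N ->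
  {subset K <= N} -> exists2 s, path step K s & last K s = N.
Proof.
move=> hK hN KN; apply: contrapT => nex.
have [||L [hL KL nL] minL] := chain_cond_extremum (Pr := fun L =>
  [/\ submod_closed L, {subset K <= L} & ~ exists2 s, path step K s & last K s = L])
  (flM (d := false)).
- by move=> L [].
- by exists N.
have [KeqL|nKL] := EM (K = L); first by apply: nL; exists [::].
have [L' mL' KL'] := exists_maximal hK hL KL nKL.
have [hL' _ L'L nLL' _] := mL'.
have [s [path_s last_s]] : exists s, path step K s /\ last K s = L'.
  apply: contrapT => nL''; apply: nLL'; rewrite -(minL L') //; split=> //.
  by case=> s ? ?; apply: nL''; exists s.
apply: nL; exists (rcons s L); last by rewrite last_rcons.
by rewrite rcons_path path_s last_s; apply/asboolP.
Qed.

(** Every submodule occurs in some composition series, hence in the unique one, and two initial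
    segments of one list are comparable. Conversely, the terms that follow a common [K] in two
    series are comparable and both minimal above [K], hence equal. *)
Lemma uniserialP : uniserial M <-> chain_above (zero_submod M).
Proof.
split=> [[s0 [_ uniq_s]] U V hU hV _ _|cM].
  have series W : submod_closed W ->
      exists s1 s2, [/\ s0 = s1 ++ s2, path step (zero_submod M) s1,
                        last (zero_submod M) s1 = W & path step W s2].
    move=> hW; have h0 := @zero_submod_closed _ M.
    have [s1 p1 l1] := exists_path h0 hW (sub_zero hW).
    have [s2 p2 l2] := exists_path hW (predT_closed M) (fun _ _ => isT).
    exists s1, s2; split=> //; apply: uniq_s; split.
      by rewrite cat_path p1 l1.
    by rewrite last_cat l1 l2.
  have [s1 [s2 [e1 p1 l1 q1]]] := series U hU.
  have [t1 [t2 [e2 p2 l2 q2]]] := series V hV.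
  have [les|/ltnW les] := leqP (size s1) (size t1); [left|right].
    have et : t1 = s1 ++ drop (size s1) t1.
      have := congr1 (take (size s1)) e2; rewrite e1 take_size_cat //.
      by rewrite takel_cat // => {1}->; rewrite cat_take_drop.
    move: p2 l2; rewrite et cat_path last_cat l1 => /andP[_ p2] <-.
    exact: path_sub.
  have et : s1 = t1 ++ drop (size t1) s1.
    have := congr1 (take (size t1)) e1; rewrite e2 take_size_cat //.
    by rewrite takel_cat // => {1}->; rewrite cat_take_drop.
  move: p1 l1; rewrite et cat_path last_cat l2 => /andP[_ p1] <-.
  exact: path_sub.
have h0 := @zero_submod_closed _ M.
have [s ps ls] := exists_path h0 (predT_closed M) (fun _ _ => isT).
exists s; split=> [|t [pt /eqi_submod lt]]; first by split; rewrite ?ls.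
elim: s t (zero_submod M) h0 ps ls pt lt => [|N s IH] [|N' t] K hK //=.
- move=> _ eK /andP[/asboolP[_ _ _ nK _] _] _; case: nK.
  by rewrite eK.
- move=> /andP[/asboolP[_ _ _ nK _] _] _ _ eK; case: nK.
  by rewrite eK.
move=> /andP[/asboolP mN ps] ls /andP[/asboolP mN' pt] lt.
have [_ hN KN nNK maxN] := mN; have [_ hN' KN' nN'K maxN'] := mN'.
have eN : N = N'.
  have [NN'|N'N] := cM N N' hN hN' (sub_zero hN) (sub_zero hN').
    by have [/eqi_submod eN|/eqi_submod] := maxN' N hN KN NN'; last by [];
       case: nNK; rewrite eN.
  by have [/eqi_submod eN|/eqi_submod] := maxN N' hN' KN' N'N; last by [];
     case: nN'K; rewrite eN.
rewrite -eN in pt lt *; congr (_ :: _).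
exact: (IH _ _ hN ps ls pt lt).
Qed.

Lemma sub_rad K N : maximal_submod K N -> {subset rad N <= K}.
Proof. by move=> mK x; rewrite inE => /andP[_ /asboolP]; apply. Qed.

Lemma rad_sub N : {subset rad N <= N}.
Proof. by move=> x; rewrite inE => /andP[]. Qed.

Lemma radn_sub i k : (i <= k)%N -> {subset radn M k <= radn M i}.
Proof.
move=> le_ik; apply: (directed_sub_le (d := false) (I := radn M) _ le_ik) => n.
exact: rad_sub.
Qed.

Lemma rad_neq N : submod_closed N -> N <> zero_submod M -> rad N <> N.
Proof.
move=> hN N0 e.
have [|K mK _] := exists_maximal (@zero_submod_closed _ M) hN (sub_zero hN).
  by move=> e0; apply: N0.
by case: (mK) => _ _ _ nNK _; apply: nNK; rewrite -{1}e; apply: sub_rad.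
Qed.

(** All maximal submodules of [N] contain [K0], so any two are comparable. There is thus only one,
    and it is the radical. *)
Lemma rad_maximal N K0 : submod_closed N -> N <> zero_submod M ->
  chain_above K0 -> {subset K0 <= rad N} -> maximal_submod (rad N) N.
Proof.
move=> hN N0 c0 K0N.
have [|K mK _] := exists_maximal (@zero_submod_closed _ M) hN (sub_zero hN).
  by move=> e0; apply: N0.
suff -> : rad N = K by [].
apply: eq_submod; first exact: sub_rad.
move=> x Kx; rewrite inE; have [hK _ KN _ _] := mK; rewrite KN //=.
apply/asboolP=> K' mK'; have [hK' _ _ _ _] := mK'.
have [||KK'|K'K] := c0 K K' hK hK'; first 2 last.
- exact: KK'.
- by rewrite (maximal_submod_eq mK' mK K'K).
- by move=> y /K0N; apply: sub_rad.
- by move=> y /K0N; apply: sub_rad.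
Qed.

(** Descend along the radical series: for i < k, a submodule properly inside rad^i lies in a maximal
    submodule of rad^i, and the only one is rad^(i+1). *)
Lemma chain_above_radn k U : chain_above (radn M k) -> submod_closed U ->
  {subset U <= radn M k} \/ exists2 j, (j <= k)%N & U = radn M j.
Proof.
move=> ck hU.
have h i : (i <= k)%N ->
    {subset U <= radn M i} \/ exists2 j, (j <= k)%N & U = radn M j.
  elim: i => [|i IH] le_ik; first by left.
  have [|UR|] := IH; [exact: ltnW| |by right].
  have [->|nU] := EM (U = radn M i).
    by right; exists i => //; apply: ltnW.
  have hR := @radn_submod_closed _ M i.
  have [K mK UK] := exists_maximal hU hR UR nU.
  have R0 : radn M i <> zero_submod M.
    move=> e0; apply: nU; apply: eq_submod => //.
    by rewrite e0; apply: sub_zero.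
  have mR : maximal_submod (rad (radn M i)) (radn M i).
    apply: rad_maximal ck _ => //; exact: (radn_sub le_ik).
  left=> x /UK; rewrite -(maximal_submod_eq mR mK) //.
  exact: sub_rad.
exact: h.
Qed.

(** A nonzero submodule differs from its radical, so the rank drops at every step until zero is
    reached. *)
Lemma radn_rank (rk : {pred M} -> nat) l : rk (zero_submod M) = 0%N ->
  (forall U, (rk U <= l)%N) ->
  (forall U V, submod_closed U -> submod_closed V -> {subset U <= V} ->
      U <> V -> (rk U < rk V)%N) ->
  forall i, (rk (radn M i) <= l - i)%N.
Proof.
move=> rk0 rk_le rk_lt; elim=> [|i IH]; first by rewrite subn0.
have hR := @radn_submod_closed _ M i; have hR' := @radn_submod_closed _ M i.+1.
have [e0|n0] := EM (radn M i = zero_submod M).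
  suff -> : radn M i.+1 = zero_submod M by rewrite rk0.
  apply: eq_submod; last exact: sub_zero.
  by move=> x Rx; have : x \in radn M i by [apply: rad_sub]; rewrite e0.
rewrite subnS -ltnS; have := rk_lt _ _ hR' hR (@rad_sub _) (rad_neq hR n0).
by move=> /leq_trans/(_ IH) lt; rewrite prednK // (leq_ltn_trans _ lt).
Qed.

End Lattice.

Arguments step {A M}.

(** * Modules all of whose proper quotients are uniserial *)

Section TwoFactor.
Variables (A : pzRingType) (M : lmodType A).
Implicit Types (U V K N : {pred M}).
Hypothesis flM : finite_length M.

Definition has_unique_maximal : Prop := forall K K' : {pred M},
  maximal_submod K predT -> maximal_submod K' predT -> K = K'.

Lemma proper_sub_maximal U : submod_closed U -> U <> predT ->
  exists2 K : {pred M}, maximal_submod K predT & {subset U <= K}.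
Proof. by move=> hU nU; apply: exists_maximal. Qed.

Lemma add_proper U V : has_unique_maximal -> submod_closed U -> submod_closed V ->
  (forall x, exists u v, [/\ u \in U, v \in V & x = u + v]) ->
  U = predT \/ V = predT.
Proof.
move=> locM hU hV UV; have [->|/(proper_sub_maximal hU)[K mK UK]] := EM (U = predT).
  by left.
have [->|/(proper_sub_maximal hV)[K' mK' VK']] := EM (V = predT); first by right.
case: (mK) => hK _ _ []; move=> x _; have [u [v [/UK Ku /VK' Kv ->]]] := UV x.
by rewrite -(locM _ _ mK mK') in Kv; apply: submodD.
Qed.

Lemma two_factor_chain_above s N : composition_series (M := M) s -> (2 <= size s)%N ->
  chain_above (radn M (size s - 2)) -> submod_closed N -> N <> zero_submod M ->
  chain_above N.
Proof.
move=> cs s2 ck hN N0 U V hU hV NU NV.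
have [rk [rk0 rk_le rk_lt]] := composition_series_rank cs.
set k := (size s - 2)%N in ck.
have rkR : (rk (radn M k) <= 2)%N.
  by apply: leq_trans (radn_rank flM rk0 rk_le rk_lt k) _; rewrite subKn.
have hR := @radn_submod_closed _ M k.
have rkN : (0 < rk N)%N.
  rewrite -rk0; apply: rk_lt => //; [exact: zero_submod_closed|exact: sub_zero|].
  by move=> e; apply: N0.
(* Since [N] is nonzero, a submodule strictly between [N] and rad^k would force rad^k to have rank
   at least 3. *)
have small W : submod_closed W -> {subset N <= W} -> {subset W <= radn M k} ->
    W = N \/ W = radn M k.
  move=> hW NW WR; have [->|nN] := EM (W = N); first by left.
  have [->|nR] := EM (W = radn M k); first by right.
  have lt1 := rk_lt _ _ hN hW NW (fun e => nN (esym e)).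
  have lt2 := rk_lt _ _ hW hR WR nR.
  by have := leq_trans (leq_ltn_trans rkN lt1) (leq_trans lt2 rkR); rewrite ltnNge leqnn.
have [UR|[i le_ik eU]] := chain_above_radn flM ck hU;
  have [VR|[j le_jk eV]] := chain_above_radn flM ck hV.
- have [->|->] := small U hU NU UR; first by left.
  by right.
- by left=> x /UR; rewrite eV; apply: radn_sub.
- by right=> x /VR; rewrite eU; apply: radn_sub.
- rewrite eU eV; have [le_ij|/ltnW le_ji] := leqP i j; [right|left]; exact: radn_sub.
Qed.

Lemma two_factor_unique_maximal s : indecomposable M ->
  composition_series (M := M) s -> (2 <= size s)%N ->
  chain_above (radn M (size s - 2)) -> has_unique_maximal.
Proof.
move=> [_ indM] cs s2 ck K K' mK mK'.
have [hK _ _ nK _] := mK; have [hK' _ _ nK' _] := mK'.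
(* In length at least 3 the exponent l - 2 is positive, so every maximal submodule contains
   rad^(l-2) and any two are comparable. *)
have [s3|s3] := leqP 3 (size s).
  have RK L : maximal_submod L predT -> {subset radn M (size s - 2) <= L}.
    move=> mL x /(@radn_sub _ M 1 _ _ x) h; apply: (sub_rad mL).
    by apply: h; rewrite subn_gt0.
  have [KK'|K'K] := ck K K' hK hK' (RK K mK) (RK K' mK').
    exact: maximal_submod_eq mK mK' KK'.
  by rewrite (maximal_submod_eq mK' mK K'K).
(* In length 2, distinct maximal submodules meet in zero and add up to [M], against
   indecomposability. *)
have [rk [rk0 rk_le rk_lt]] := composition_series_rank cs.
apply: contrapT => nKK'.
have nK'K : ~ {subset K' <= K}.
  by move=> s'; apply: nKK'; rewrite (maximal_submod_eq mK' mK s').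
have nsKK' : ~ {subset K <= K'} by move/(maximal_submod_eq mK mK').
have hC := capsm_closed hK hK'.
have C0 x : x \in K -> x \in K' -> x = 0.
  move=> Kx K'x; apply: contrapT => x0.
  have lt0 : (rk (zero_submod M) < rk (capsm K K'))%N.
    apply: rk_lt => //; [exact: zero_submod_closed|exact: sub_zero|] => e.
    have : x \in capsm K K' by rewrite inE Kx.
    by rewrite -e inE => /eqP.
  have lt1 : (rk (capsm K K') < rk K)%N.
    apply: rk_lt => // [y|e]; first by rewrite inE => /andP[].
    by apply: nsKK' => y; rewrite -e inE => /andP[].
  have lt2 : (rk K < rk predT)%N.
    by apply: rk_lt => // e; apply: nK => y _; rewrite e.
  rewrite rk0 in lt0.
  have := leq_trans (leq_ltn_trans (leq_ltn_trans lt0 lt1) lt2) (rk_le _).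
  by rewrite leqNgt s3.
have [|//|/eqi_submod e|/eqi_submod e] := indM K K' hK hK'.
- move=> x; have : x \in addsm K' K.
    by rewrite (maximal_submod_add mK hK' (fun _ _ => isT) nK'K).
  by case/addsmP=> u [v [K'u Kv ->]]; exists v, u; rewrite addrC.
- by apply: nsKK'; rewrite e; apply: sub_zero.
- by apply: nK'K; rewrite e; apply: sub_zero.
Qed.

(** If rad^(j+1) is the first radical to vanish, the radical series is a composition series above
    rad^j. It remains to show that rad^j has length 2. *)
Lemma exists_two_factor_series :
  (forall N, submod_closed N -> N <> zero_submod M -> chain_above N) ->
  ~ chain_above (zero_submod M) ->
  exists s, [/\ composition_series (M := M) s, (2 <= size s)%N,
    chain_above (radn M (size s - 2)) & ~ chain_above (radn M (size s - 1))].
Proof.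
move=> cN nc0; have h0 := @zero_submod_closed _ M.
have hR i : submod_closed (radn M i) by apply: radn_submod_closed.
have ex0 : exists n, `[< radn M n = zero_submod M >].
  have [||n st] := flM (d := false) hR; first by [].
    by move=> n; apply: rad_sub.
  exists n; apply/asboolP; apply: contrapT => n0.
  by apply: (rad_neq flM (hR n) n0); apply: (st n.+1).
case: (ex_minnP ex0) => [[|j]] /asboolP Rj minj.
  case: nc0 => U V _ hV _ _; left=> x _.
  have : x \in radn M 0 by [].
  by rewrite Rj inE => /eqP->; rewrite submod0.
have Rn0 i : (i <= j)%N -> radn M i <> zero_submod M.
  by move=> le_ij e; have := minj i; rewrite ltnNge le_ij => /(_ (asboolT e)).
have cj := cN _ (hR j) (Rn0 j (leqnn j)).
have mR i : (i < j)%N -> maximal_submod (radn M i.+1) (radn M i).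
  move=> lt_ij; apply: (rad_maximal flM (hR i) (Rn0 i (ltnW lt_ij)) cj).
  exact: (radn_sub lt_ij).
have series i : (i <= j)%N -> exists s : seq {pred M},
    [/\ path step (radn M i) s, last (radn M i) s = predT & size s = i].
  elim: i => [|i IH] lt_ij; first by exists [::].
  have [s [ps ls ss]] := IH (ltnW lt_ij).
  exists (radn M i :: s); split=> //=; last by rewrite ss.
  by rewrite ps andbT; apply/asboolP/mR.
have [s [ps ls ss]] := series j (leqnn j).
have [|K mK _] := exists_maximal flM h0 (hR j) (sub_zero (hR j)).
  by move=> e; apply: (Rn0 j).
have [hK _ KR nRK maxK] := mK.
(* Otherwise rad^j would be simple and the submodules of [M] would form a chain. *)
have K0 : K <> zero_submod M.
  move=> eK; rewrite eK in maxK; apply: nc0 => U V hU hV _ _.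
  have small W : submod_closed W -> {subset W <= radn M j} ->
      W = zero_submod M \/ W = radn M j.
    by move=> hW WR; have [] := maxK W hW (sub_zero hW) WR => /eqi_submod; auto.
  have [UR|[i le_ij eU]] := chain_above_radn flM cj hU;
    have [VR|[i' le_i'j eV]] := chain_above_radn flM cj hV.
  - have [->|->] := small U hU UR; first by left; apply: sub_zero.
    by right.
  - by left=> x /UR; rewrite eV; apply: radn_sub.
  - by right=> x /VR; rewrite eU; apply: radn_sub.
  - by rewrite eU eV; have [?|/ltnW ?] := leqP i i'; [right|left]; exact: radn_sub.
have [x Kx x0] := submod_neq0 hK K0.
(* Such a [K2] exists because rad^(j+1), the intersection of the maximal submodules of rad^j, is
   zero. *)
have [K2 mK2 nK2x] : exists2 K2 : {pred M}, maximal_submod K2 (radn M j) & x \notin K2.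
  apply: contrapT => h; apply: x0; apply/eqP.
  suff : x \in radn M j.+1 by rewrite Rj inE.
  rewrite -[radn M j.+1]/(rad (radn M j)) inE KR //=; apply/asboolP => K2 mK2.
  by apply: contrapT => /negP nx; apply: h; exists K2.
have [hK2 _ K2R nRK2 maxK2] := mK2.
have nKK2 : ~ {subset K <= K2} by move/(_ x Kx); apply/negP.
have nK2K : ~ {subset K2 <= K}.
  by move/(maximal_submod_eq mK2 mK) => e; apply: nKK2; rewrite e.
have cap0 y : y \in K -> y \in K2 -> y = 0.
  move=> Ky K2y; apply: contrapT => y0.
  have hC := capsm_closed hK hK2.
  have C0 : capsm K K2 <> zero_submod M.
    move=> e; have : y \in capsm K K2 by rewrite inE Ky.
    by rewrite e inE => /eqP.
  have [||//|//] := cN _ hC C0 K K2 hK hK2; by move=> z; rewrite inE => /andP[].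
(* [K] is simple: for nonzero K' in [K], both [K] and K' + K2 contain K', so they are comparable.
   [K2] does not lie in [K], so [K] lies in K' + K2, and then K = K' because [K] meets [K2] in
   zero. *)
have m0K : maximal_submod (zero_submod M) K.
  split=> //; first exact: sub_zero.
    by move=> sK; apply: K0; apply: eq_submod => //; apply: sub_zero.
  move=> K' hK' _ K'K; have [->|n0] := EM (K' = zero_submod M); first by left.
  right; suff -> : K' = K by [].
  have hKK := addsm_closed hK' hK2.
  have [||sub|sub] := cN _ hK' n0 K (addsm K' K2) hK hKK => //.
  - exact: sub_addsml.
  - apply: eq_submod => // k Kk; have /addsmP[k' [k2 [K'k' K2k2 def_k]]] := sub k Kk.
    have k20 : k2 = 0.
      apply: cap0 => //; have -> : k2 = k - k' by rewrite def_k addrAC subrr add0r.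
      by apply: submodB => //; apply: K'K.
    by rewrite def_k k20 addr0.
  - by case: nK2K => k K2k; apply: sub; apply: sub_addsmr.
(* The length is j + 2, so the two radicals in question are rad^j and rad^(j+1) = 0. *)
exists [:: K, radn M j & s]; rewrite /= ss !subSS !subn0; split=> //.
  split; last by rewrite /= ls.
  by rewrite /= ps !andbT; apply/andP; split; apply/asboolP.
by rewrite -[rad _]/(radn M j.+1) Rj.
Qed.

End TwoFactor.

(** * Quotients, submodules and projective modules *)

Section Surjections.
Variables (A : pzRingType) (P Q : lmodType A) (f : {linear P -> Q}).
Hypothesis f_surj : forall y, exists x, f x = y.

Lemma chain_above_surj :
  chain_above (zero_submod Q) <-> chain_above (preimsm f (zero_submod Q)).
Proof.
split=> [c U V hU hV kU kV | c U V hU hV _ _].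
  have im W W' : submod_closed W' -> {subset preimsm f (zero_submod Q) <= W'} ->
      {subset imsm f W <= imsm f W'} -> {subset W <= W'}.
    move=> hW' kW' sWW' x Wx; have /imsmP[y Wy fxy] := sWW' _ (mem_imsm f Wx).
    rewrite -(subrK y x); apply: submodD => //; apply: kW'.
    by rewrite !inE linearB fxy subrr.
  have [|||||] := c (imsm f U) (imsm f V).
  - exact: imsm_closed.
  - exact: imsm_closed.
  - exact/sub_zero/imsm_closed.
  - exact/sub_zero/imsm_closed.
  - by move/im; left; auto.
  - by move/im; right; auto.
have [||||UV|VU] := c (preimsm f U) (preimsm f V).
- exact: preimsm_closed.
- exact: preimsm_closed.
- by move=> x; rewrite !inE => /eqP->; apply: submod0.
- by move=> x; rewrite !inE => /eqP->; apply: submod0.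
- by left=> y; have [x <-] := f_surj y => Ux; apply: UV.
- by right=> y; have [x <-] := f_surj y => Vx; apply: VU.
Qed.

Lemma fin_gen_surj : fin_gen P -> fin_gen Q.
Proof.
move=> /fin_genP[s hs]; apply/fin_genP; exists (map f s) => y.
have [x <-] := f_surj y; move: {hs} (hs x).
elim: s x => [|z s IH] x /=; first by rewrite inE => /eqP->; rewrite linear0 inE.
case/addsmP=> _ [v [/cyclicsmP[a ->] /IH sv ->]].
rewrite linearD linearZ; apply/addsmP; exists (a *: f z), (f v); split=> //.
by apply/cyclicsmP; exists a.
Qed.

End Surjections.

Section Quotients.
Variables (A : pzRingType) (M : lmodType A) (N : {pred M}).
Hypothesis subN : submod_closed N.

Fact quotmod_pi_linear : linear (quotmod_pi subN).
Proof. by move=> a x y; rewrite quotmod_piD quotmod_piZ. Qed.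

HB.instance Definition _ := GRing.isLinear.Build A M (quotmod subN) *:%R
  (quotmod_pi subN) quotmod_pi_linear.

Lemma quotmod_pi_surj u : exists x, quotmod_pi subN x = u.
Proof. by exists (quotmod_repr u); rewrite quotmod_reprK. Qed.

Lemma quotmod_pi_eq0 x : (quotmod_pi subN x == 0) = (x \in N).
Proof. by rewrite -(linear0 (quotmod_pi subN)) quotmod_pi_eq subr0. Qed.

Lemma ker_quotmod_pi : preimsm (quotmod_pi subN) (zero_submod _) = N.
Proof. by apply: eqi_submod => x; rewrite inE inE quotmod_pi_eq0. Qed.

Lemma fin_gen_quotmod : fin_gen M -> fin_gen (quotmod subN).
Proof. exact: (fin_gen_surj quotmod_pi_surj). Qed.

Lemma chain_above_quotmod :
  chain_above (zero_submod (quotmod subN)) <-> chain_above N.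
Proof. by rewrite (chain_above_surj quotmod_pi_surj) ker_quotmod_pi. Qed.

End Quotients.

Section SubmoduleType.
Variables (A : pzRingType) (M : lmodType A) (N : {pred M}).
Hypothesis subN : submod_closed N.

Definition submod_pred : submodClosed M :=
  HB.pack (N : M -> bool) (GRing.isSubmodClosed.Build A M (N : M -> bool) subN).

Definition submod : Type := {x : M | x \in submod_pred}.
HB.instance Definition _ := SubChoice.on submod.
HB.instance Definition _ := [SubChoice_isSubLmodule of submod by <:].

Definition submod_val : {linear submod -> M} := val.

Lemma submod_valP (u : submod) : submod_val u \in N.
Proof. exact: valP u. Qed.

Lemma submod_val_inj : injective submod_val.
Proof. exact: val_inj. Qed.

Lemma submod_val_onto x : x \in N -> exists u, submod_val u = x.
Proof. by move=> Nx; exists (exist _ x Nx). Qed.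

(** The projection along [V] sends x to the only u in [N] with x - u in [V]; uniqueness makes it
    linear. *)
Lemma submod_retraction (V : {pred M}) : submod_closed V ->
  (forall x, exists u v, [/\ u \in N, v \in V & x = u + v]) ->
  (forall x, x \in N -> x \in V -> x = 0) ->
  exists p : {linear M -> submod}, forall u, p (submod_val u) = u.
Proof.
move=> hV NV N0.
have ex_p x : exists u : submod, x - submod_val u \in V.
  have [u [v [/submod_val_onto[u' <-] Vv ->]]] := NV x.
  by exists u'; rewrite addrAC subrr add0r.
have [f fV] := choice ex_p.
have uniq_f x u : x - submod_val u \in V -> f x = u.
  move=> Vu; apply: submod_val_inj; apply/eqP; rewrite -subr_eq0; apply/eqP.
  rewrite -linearB; apply: N0; first exact: submod_valP.
  rewrite linearB; set w := submod_val (f x); set w' := submod_val u.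
  have -> : w - w' = (x - w') - (x - w) by rewrite opprB [RHS]addrC addrA subrK.
  exact: submodB.
have [|p pE] := @exists_linear A M submod f.
  move=> a x y; apply: uniq_f; rewrite [submod_val _]linearP opprD addrACA -scalerBr.
  by apply: submodD => //; apply: submodZ.
by exists p => u; rewrite pE; apply: uniq_f; rewrite subrr submod0.
Qed.

End SubmoduleType.

(** * Projective modules and Fitting's lemma *)

Section Projective.
Variable A : pzRingType.

Lemma fin_gen_regular : fin_gen A^o.
Proof.
apply/fin_genP; exists [:: 1] => a; apply/addsmP; exists a, 0.
split; [apply/cyclicsmP; exists a | by rewrite inE | by rewrite addr0].
by rewrite -[RHS]/(a * 1) mulr1.
Qed.

Lemma projective_regular : projective A^o.
Proof.
move=> X Y _ _ g f g_surj; have [x gx] := g_surj (f 1).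
have [|h hE] := @exists_linear A A^o X (fun a => a *: x).
  by move=> a b c; rewrite scalerDl scalerA.
exists h => a; rewrite hE linearZ gx -linearZ; congr (f _).
by rewrite -[LHS]/(a * 1) mulr1.
Qed.

Lemma projective_retract (P Q : lmodType A) (i : {linear Q -> P})
    (p : {linear P -> Q}) :
  (forall x, p (i x) = x) -> projective P -> projective Q.
Proof.
move=> pi projP X Y fX fY g f g_surj.
have [h hE] := projP X Y fX fY g (f \o p : {linear P -> Y}) g_surj.
by exists (h \o i : {linear Q -> X}) => x; rewrite /= hE /= pi.
Qed.

Lemma projective_bij (P Q : lmodType A) (g : {linear P -> Q}) :
  (forall y, exists x, g x = y) -> (forall x, g x = 0 -> x = 0) ->
  projective P -> projective Q.
Proof.
move=> g_surj g0; have [f fE] := choice g_surj.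
have [|i iE] := @exists_linear A Q P f.
  move=> a x y; apply/eqP; rewrite -subr_eq0; apply/eqP/g0.
  by rewrite linearB linearP !fE subrr.
by apply: (projective_retract (i := i) (p := g)) => x; rewrite iE.
Qed.

Section Fitting.
Variables (P : lmodType A) (h : {linear P -> P}).
Hypotheses (flP : finite_length P) (indP : indecomposable P).

(** For large [n] the images and the kernels of the powers of [h] are stationary, so [P] is the
    direct sum of the image and the kernel of h^n, and one of them vanishes. *)
Lemma fitting :
  (exists n, forall x, iter n h x = 0) \/ (forall y, exists x, h x = y).
Proof.
have hn n : exists f : {linear P -> P}, f =1 iter n h.
  apply: exists_linear; elim: n => [//|n IH] a x y.
  by rewrite !iterS IH linearP.
pose im n : {pred P} := [pred y | `[< exists x, y = iter n h x >]].
have imP n y : reflect (exists x, y = iter n h x) (y \in im n) by apply: asboolP.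
pose ker n : {pred P} := [pred x | iter n h x == 0].
have him n : submod_closed (im n).
  have [f fE] := hn n; split; first by apply/imP; exists 0; rewrite -fE linear0.
  move=> a _ _ /imP[x ->] /imP[y ->]; apply/imP; exists (a *: x + y).
  by rewrite -!fE linearP.
have hker n : submod_closed (ker n).
  have [f fE] := hn n; split; first by rewrite inE -fE linear0.
  move=> a x y; rewrite !inE -!fE linearP => /eqP-> /eqP->.
  by rewrite scaler0 addr0.
have [||n1 st1] := flP (d := false) him; first by [].
  by move=> n _ /imP[x ->]; apply/imP; exists (h x); rewrite iterSr.
have [||n2 st2] := flP (d := true) hker; first by [].
  by move=> n x; rewrite !inE iterS => /eqP->; rewrite linear0.
(* A successor, so that an element h^n z can be read at the end as a value of [h]. *)
pose n := (maxn n1 n2).+1.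
have le1 : (n1 <= n)%N by rewrite leqW ?leq_maxl.
have le2 : (n2 <= n)%N by rewrite leqW ?leq_maxr.
have imnn : im (n + n)%N = im n by rewrite !st1 // (leq_trans le1) ?leq_addr.
have kernn : ker (n + n)%N = ker n by rewrite !st2 // (leq_trans le2) ?leq_addr.
have split_im x : exists z, x - iter n h z \in ker n.
  have /imP[z def_z] : iter n h x \in im (n + n)%N by rewrite imnn; apply/imP; exists x.
  exists z; have [f fE] := hn n.
  by rewrite inE -fE linearB !fE -iterD -def_z subrr.
have [_ ind] := indP.
have [||im0|ker0] := ind (im n) (ker n) (him n) (hker n).
- move=> x; have [z kz] := split_im x.
  exists (iter n h z), (x - iter n h z); split=> //; first by apply/imP; exists z.
  by rewrite addrC subrK.
- move=> _ /imP[x ->]; rewrite inE -iterD => /eqP kx.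
  have : x \in ker (n + n)%N by rewrite inE kx.
  by rewrite kernn inE => /eqP.
- left; exists n => x; have : iter n h x \in im n by apply/imP; exists x.
  by rewrite im0 inE => /eqP.
- right=> y; have [z] := split_im y; rewrite ker0 inE subr_eq0 => /eqP->.
  by exists (iter (maxn n1 n2) h z).
Qed.

End Fitting.

(* For distinct maximal submodules [K], [K'] lift the projection on [P / K]
   through a cyclic submodule of [K']: the resulting endomorphism is the
   identity modulo [K] and is not onto, against Fitting's lemma. *)
Lemma projective_unique_maximal (P : lmodType A) : finite_length P ->
  fin_gen P -> indecomposable P -> projective P -> has_unique_maximal P.
Proof.
move=> flP fgP indP projP K K' mK mK'; apply: contrapT => nKK'.
have [hK _ _ nK _] := mK; have [hK' _ _ nK' _] := mK'.
have /nsubset[x K'x nKx] : ~ {subset K' <= K}.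
  by move=> s; apply: nKK'; rewrite (maximal_submod_eq mK' mK s).
pose pi : {linear P -> quotmod hK} := quotmod_pi hK.
(* As [x] lies in [K'] but not in [K], its multiples stay in [K'] and map onto P / K. *)
have [|m mE] := @exists_linear A A^o P (fun a => (a : A) *: x).
  by move=> a b c; rewrite scalerDl scalerA.
have [|||h hE] := projP A^o (quotmod hK) _ _ (pi \o m : {linear _ -> _}) pi.
- exact: fin_gen_regular.
- exact: fin_gen_quotmod.
- move=> u; have [y <-] := quotmod_pi_surj u.
  have : y \in addsm (cyclicsm x) K.
    rewrite (maximal_submod_add mK (cyclicsm_closed x) (fun _ _ => isT)) //.
    by move/(_ x (mem_cyclicsm x)); apply/negP.
  case/addsmP=> _ [k [/cyclicsmP[a ->] Kk ->]]; exists a.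
  rewrite /= mE; apply/eqP; rewrite quotmod_pi_eq opprD addrA subrr add0r.
  exact: submodN.
have hK'm p : m (h p) \in K' by rewrite mE; apply: submodZ.
have hKm p : m (h p) - p \in K by rewrite -quotmod_pi_eq; apply/eqP; apply: hE.
have [[n nil]|onto] := fitting (m \o h : {linear P -> P}) flP indP.
  apply: nK => p _.
  (* The endomorphism is the identity modulo [K], and so are its iterates; if one of them vanished,
     [K] would be everything. *)
  have : iter n (m \o h) p - p \in K.
    elim: n {nil} => [|n IH]; first by rewrite subrr submod0.
    rewrite iterS -(subrKA (iter n (m \o h) p)).
    by apply: (submodD hK) => //; apply: hKm.
  by rewrite nil sub0r => /(submodN hK); rewrite opprK.
by apply: nK' => p _; have [q <-] := onto p; apply: hK'm.
Qed.

(** A section of the projection onto P / N would make [N] a direct summand that is neither zero nor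
    everything. *)
Lemma projective_quotmod (P : lmodType A) (N : {pred P}) (hN : submod_closed N) :
  fin_gen P -> indecomposable P -> N <> zero_submod P -> N <> predT ->
  ~ projective (quotmod hN).
Proof.
move=> fgP [_ indP] N0 NT projQ.
pose pi : {linear P -> quotmod hN} := quotmod_pi hN.
have fgQ := fin_gen_quotmod hN fgP.
have idl : linear (id : quotmod hN -> quotmod hN) by [].
have [h0 h0E] := exists_linear idl.
have [h hE] := projQ P (quotmod hN) fgP fgQ pi h0 (quotmod_pi_surj (subN := hN)).
have hT : submod_closed (predT : {pred quotmod hN}) by [].
have [||/eqi_submod e|/eqi_submod //] := indP _ N (imsm_closed h hT) hN.
- move=> x; exists (h (pi x)), (x - h (pi x)); split; first exact: mem_imsm.
    by rewrite -quotmod_pi_eq -[X in _ == X]/(pi _) hE h0E.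
  by rewrite addrC subrK.
- move=> _ /imsmP[u _ ->]; rewrite -(quotmod_pi_eq0 hN) -[quotmod_pi _ _]/(pi _).
  by rewrite hE h0E => /eqP->; rewrite linear0.
apply: NT; apply: eq_submod => // x _; rewrite -(quotmod_pi_eq0 hN).
have : h (pi x) \in imsm h predT by apply: mem_imsm.
rewrite e inE -[quotmod_pi _ _]/(pi _) -[pi x in X in _ -> X]h0E -hE => /eqP->.
by rewrite linear0.
Qed.

(** The preimages of two summands add up to [P], so one of them is all of [P]. The corresponding
    summand is then the whole quotient, and the other is zero. *)
Lemma indecomposable_quotmod (P : lmodType A) (N : {pred P})
    (hN : submod_closed N) : finite_length P -> has_unique_maximal P ->
  N <> predT -> indecomposable (quotmod hN).
Proof.
move=> flP locP NT; split.
  apply: contrapT => h; apply: NT; apply: eq_submod => // x _.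
  rewrite -(quotmod_pi_eq0 hN); apply: contrapT => /negP nx.
  by apply: h; exists (quotmod_pi hN x).
pose pi : {linear P -> quotmod hN} := quotmod_pi hN.
move=> U V hU hV UV UV0.
have [|||eU|eV] := @add_proper _ _ flP (preimsm pi U) (preimsm pi V) locP.
- exact: preimsm_closed.
- exact: preimsm_closed.
- move=> x; have [u [v [Uu Vv def_x]]] := UV (pi x).
  have [u' def_u] := quotmod_pi_surj u.
  exists u', (x - u'); rewrite !inE linearB def_x -[pi u']/(quotmod_pi hN u') def_u.
  by rewrite addrAC subrr add0r addrC subrK.
- right=> v; rewrite inE; apply/idP/eqP => [Vv|->].
    apply: UV0 => //; have [x def_v] := quotmod_pi_surj v.
    have : x \in preimsm pi U by rewrite eU.
    by rewrite inE -[pi x]/(quotmod_pi hN x) def_v.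
  exact: submod0.
- left=> u; rewrite inE; apply/idP/eqP => [Uu|->].
    apply: UV0 => //; have [x def_u] := quotmod_pi_surj u.
    have : x \in preimsm pi V by rewrite eV.
    by rewrite inE -[pi x]/(quotmod_pi hN x) def_u.
  exact: submod0.
Qed.

(* A direct summand [U] of the regular module, minimal among those with
   [U x = M], is indecomposable. *)
Lemma projective_cover_local (M : lmodType A) : finite_length A^o ->
  finite_length M -> nonzero M -> has_unique_maximal M ->
  exists (P : lmodType A) (g : {linear P -> M}),
    [/\ fin_gen P, indecomposable P, projective P & forall y, exists x, g x = y].
Proof.
move=> flA flM [z z0] locM.
have zT : zero_submod M <> predT.
  move=> e; have : z \in zero_submod M by rewrite e.
  by rewrite inE (negbTE z0).
have [K mK _] := proper_sub_maximal flM (@zero_submod_closed _ M) zT.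
have [hK _ _ nK _] := mK.
have /nsubset[x _ nKx] := nK.
have [|m mE] := @exists_linear A A^o M (fun a => (a : A) *: x).
  by move=> a b c; rewrite scalerDl scalerA.
pose gen (U : {pred A^o}) := imsm m U = predT.
pose summand (U : {pred A^o}) := exists V : {pred A^o}, [/\ submod_closed V,
  forall a, exists u v, [/\ u \in U, v \in V & a = u + v] &
  forall a, a \in U -> a \in V -> a = 0].
have [||U [hU [V [hV UV UV0]] genU] minU] := chain_cond_extremum
    (Pr := fun U => [/\ submod_closed U, summand U & gen U]) (flA false).
- by move=> U [].
- exists (fun=> true); split=> //.
    exists (zero_submod A^o); split; first exact: zero_submod_closed.
      by move=> a; exists a, 0; rewrite addr0 inE.
    by move=> a _; rewrite inE => /eqP.
  have hm : submod_closed (imsm m (fun=> true)) by apply: imsm_closed.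
  (* A proper image would lie in the only maximal submodule, which misses [x]. *)
  apply: contrapT => /(proper_sub_maximal flM hm)[K' mK' imK'].
  move/negP: nKx; apply; rewrite (locM _ _ mK mK'); apply: imK'.
  by apply/imsmP; exists 1; rewrite ?mE ?scale1r.
have [p pE] := submod_retraction hU hV UV UV0.
pose P : lmodType A := submod hU; pose i : {linear P -> A^o} := submod_val hU.
have p_surj u : exists a, p a = u by exists (i u); apply: pE.
exists P, (m \o i : {linear P -> M}); split; first last.
- move=> y; have : y \in imsm m U by rewrite genU.
  by case/imsmP=> u /(submod_val_onto hU)[u' <-] ->; exists u'.
- exact: projective_retract pE projective_regular.
- split.
    apply: contrapT => h; move/eqP: z0; apply.
    have : z \in imsm m U by rewrite genU.
    case/imsmP=> u /(submod_val_onto hU)[u' <-] ->.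
    suff -> : u' = 0 by rewrite !linear0.
    by apply/eqP; apply: contrapT => /negP nu; apply: h; exists u'.
  (* If one half [W] of a decomposition of [U] already generates [M], it is itself a summand, with
     complement W' + V. Minimality gives W = U, hence W' = 0. *)
  have half (W W' : {pred P}) : submod_closed W -> submod_closed W' ->
      (forall u, exists w w', [/\ w \in W, w' \in W' & u = w + w']) ->
      (forall u, u \in W -> u \in W' -> u = 0) ->
      imsm m (imsm i W) = predT -> W' =i zero_submod P.
    move=> hW hW' WW' WW'0 genW.
    have eW : imsm i W = U.
      apply: minU; last by move=> _ /imsmP[w _ ->]; apply: submod_valP.
      split=> //; first exact: imsm_closed.
      exists (addsm (imsm i W') V); split.
      - by apply: addsm_closed => //; apply: imsm_closed.
      - move=> a; have [u [v [/(submod_val_onto hU)[u' <-] Vv ->]]] := UV a.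
        have [w [w' [Ww W'w' ->]]] := WW' u'.
        exists (i w), (i w' + v); split; first exact: mem_imsm.
          by apply/addsmP; exists (i w'), v; split=> //; apply: mem_imsm.
        by rewrite linearD addrA.
      - move=> _ /imsmP[w Ww ->] /addsmP[_ [v [/imsmP[w' W'w' ->] Vv def_w]]].
        have v0 : v = 0.
          apply: UV0 => //; have -> : v = i w - i w' by rewrite def_w addrAC subrr add0r.
          by rewrite -linearB; apply: submod_valP.
        rewrite (WW'0 w) ?linear0 //.
        have -> : w = w' by apply: submod_val_inj; rewrite -[RHS]addr0 -v0.
        by [].
    move=> u; rewrite inE; apply/idP/eqP => [W'u|->]; last exact: submod0.
    have : i u \in imsm i W by rewrite eW; apply: submod_valP.
    by case/imsmP=> w Ww /submod_val_inj e; apply: WW'0 => //; rewrite e.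
  move=> W W' hW hW' WW' WW'0.
  have hm (T : {pred P}) : submod_closed T -> submod_closed (imsm m (imsm i T)).
    by move=> hT; do 2!apply: imsm_closed.
  (* The images of [W] and [W'] add up to [M], so one of them is all of [M]. *)
  have [|e|e] := add_proper flM locM (hm W hW) (hm W' hW').
  - move=> y; have : y \in imsm m U by rewrite genU.
    case/imsmP=> _ /(submod_val_onto hU)[u <-] ->.
    have [w [w' [Ww W'w' ->]]] := WW' u.
    exists (m (i w)), (m (i w')); split; try by do 2!apply: mem_imsm.
    by rewrite !linearD.
  - by right; apply: half e.
  - left; apply: (half W' W) e => // [u|u W'u Wu]; last exact: WW'0.
    by have [w [w' [? ? ->]]] := WW' u; exists w', w; rewrite addrC.
- exact: fin_gen_surj p_surj fin_gen_regular.
Qed.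

End Projective.

(** * The two implications, for rings whose finitely generated modules have finite length *)

Section FiniteLengthModules.
Variable A : pzRingType.
Hypothesis fin_gen_fl : forall M : lmodType A, fin_gen M -> finite_length M.

(** This trades the quotients in the definition for conditions on submodules of [M], and the length
    for the size of an actual series. *)
Lemma two_factor_serialP (M : lmodType A) : fin_gen M ->
  two_factor_serial M <-> exists s : seq {pred M},
    [/\ composition_series s, (2 <= size s)%N,
      chain_above (radn M (size s - 2)) & ~ chain_above (radn M (size s - 1))].
Proof.
move=> fgM.
have uniP i : uniserial (quotmod (radn_submod_closed M i)) <->
    chain_above (radn M i).
  have flQ := fin_gen_fl (fin_gen_quotmod (radn_submod_closed M i) fgM).
  by rewrite (uniserialP flQ) chain_above_quotmod.
split=> [[l [l2 [s cs def_l] /uniP c2 c1]]|[s [cs s2 c2 c1]]].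
  by subst l; exists s; split=> // /uniP.
by exists (size s); split=> //; [exists s | apply/uniP | move/uniP].
Qed.

Lemma indecomposable_nonprojective_uniserial (M : lmodType A) :
  (forall P : lmodType A, fin_gen P -> indecomposable P ->
     one_factor_serial P \/ two_factor_serial P) ->
  fin_gen M -> indecomposable M -> ~ projective M -> uniserial M.
Proof.
move=> serial fgM indM nprojM.
have flM := fin_gen_fl fgM.
have [[]//|/(two_factor_serialP fgM)[s [cs s2 c2 _]]] := serial M fgM indM.
have locM := two_factor_unique_maximal indM cs s2 c2.
have flA := fin_gen_fl (@fin_gen_regular A).
have [P [g [fgP indP projP g_surj]]] := projective_cover_local flA flM indM.1 locM.
have flP := fin_gen_fl fgP; pose N := preimsm g (zero_submod M).
have hN : submod_closed N := preimsm_closed g (@zero_submod_closed _ M).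
(* A zero kernel would make [g] an isomorphism and [M] projective. *)
have N0 : N <> zero_submod P.
  move=> eN; apply: nprojM; apply: (projective_bij g_surj) projP => x gx0.
  have : x \in N by rewrite !inE gx0.
  by rewrite eN inE => /eqP.
apply/(uniserialP flM)/(chain_above_surj g_surj).
have [[_ /(uniserialP flP)]|] := serial P fgP indP.
  by apply: chain_above_sub; apply: sub_zero.
move=> /(two_factor_serialP fgP)[t [ct t2 d2 _]].
exact: (two_factor_chain_above flP ct t2 d2 hN N0).
Qed.

Lemma indecomposable_two_factor_serial (M : lmodType A) :
  (forall P : lmodType A, fin_gen P -> indecomposable P -> ~ projective P ->
     uniserial P) ->
  fin_gen M -> indecomposable M -> ~ uniserial M -> two_factor_serial M.
Proof.
move=> uni fgM indM nuniM; have flM := fin_gen_fl fgM.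
have projM : projective M by apply: contrapT => /(uni M fgM indM).
have locM := projective_unique_maximal flM fgM indM projM.
apply/(two_factor_serialP fgM)/(exists_two_factor_series flM); last first.
  by move/(uniserialP flM).
(* The zero quotient is treated apart, as it is not indecomposable. *)
move=> N hN N0; have [->|NT] := EM (N = predT).
  by move=> U V _ _ TU TV; left=> x _; apply: TV.
apply/(chain_above_quotmod hN).
have fgQ := fin_gen_quotmod hN fgM.
apply/(uniserialP (fin_gen_fl fgQ))/uni => //.
  exact: indecomposable_quotmod.
exact: projective_quotmod.
Qed.

End FiniteLengthModules.

Theorem theorem5p8 (R : comPzRingType) (L : algType R) :
  artin_algebra L -> ~ nakayama L ->
  (right_two_nakayama L <->
   forall M : rmodType L,
     fin_gen M -> indecomposable M -> ~ projective M -> uniserial M).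
Proof.
move=> artL nnakL.
have fl (M : rmodType L) : fin_gen M -> finite_length M.
  by move=> fgM d; apply: artin_algebra_chain_cond.
split=> [[serial _] M|uni].
  exact: indecomposable_nonprojective_uniserial.
split=> [M fgM indM|].
  have [uM|nuM] := EM (uniserial M); first by left; split=> //; case: indM.
  by right; apply: indecomposable_two_factor_serial.
(* Without a 2-factor serial indecomposable, every indecomposable would be uniserial, in particular
   the projective and the injective ones, so the algebra would be Nakayama. *)
apply: contrapT => nex; apply: nnakL.
have all_uni (M : rmodType L) : fin_gen M -> indecomposable M -> uniserial M.
  move=> fgM indM; apply: contrapT => nuM; apply: nex; exists M; split=> //.
  exact: indecomposable_two_factor_serial.
by split=> M fgM indM _; apply: all_uni.
Qed.
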